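(* If $\mathcal{F}$ is a minimal DSF set consisting of $k$ graphs, then every element of $\mathcal{F}$ has at most $$4k-\frac{3}{2}+\sqrt{8k^2+2k-\frac{31}{4}}$$ vertices. Consequently, for each positive integer $k$ there are only finitely many minimal DSF sets with exactly $k$ elements.
   Context: All graphs are finite and simple, considered up to isomorphism. For a set $\mathcal{F}$ of graphs, a graph is $\mathcal{F}$-free if none of its induced subgraphs is isomorphic to a member of $\mathcal{F}$. A set $\mathcal{F}$ of graphs is degree-sequence-forcing (DSF) if whenever some realization of a degree sequence $d$ (a graph with degree sequence $d$) is $\mathcal{F}$-free, every realization of $d$ is $\mathcal{F}$-free. A DSF set is minimal if no proper subset of it is DSF. *)

(* Defs.v *)
From HB Require Import structures.
From mathcomp Require Import all_boot all_order all_algebra generic_quotient.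
From mathcomp Require Import boolp classical_sets cardinality reals.

Set Implicit Arguments.
Unset Strict Implicit.
Unset Printing Implicit Defensive.

Definition simple_adj n (e : {ffun 'I_n -> {ffun 'I_n -> bool}}) : bool :=
  [forall u, ~~ e u u] && [forall u, forall v, e u v == e v u].

Record graph_on n := GraphOn {
  adj_ffun : {ffun 'I_n -> {ffun 'I_n -> bool}};
  adj_ffunP : simple_adj adj_ffun }.

HB.instance Definition _ n := [isSub for @adj_ffun n].
HB.instance Definition _ n := [Choice of graph_on n by <:].

(* The null graph, with no vertices, is allowed. *)
Definition graph := {n : nat & graph_on n}.
HB.instance Definition _ := Choice.on graph.

Definition num_vertices (G : graph) : nat := tag G.
Definition vertex (G : graph) := 'I_(num_vertices G).
HB.instance Definition _ G := Finite.on (vertex G).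

Definition adj (G : graph) (u v : vertex G) : bool := adj_ffun (tagged G) u v.

Lemma adj_irr (G : graph) (u : vertex G) : adj u u = false.
Proof.
by apply/negbTE; case/andP: (adj_ffunP (tagged G)) => /forallP + _; apply.
Qed.

Lemma adj_sym (G : graph) (u v : vertex G) : adj u v = adj v u.
Proof.
case/andP: (adj_ffunP (tagged G)) => _ /forallP/(_ u)/forallP/(_ v).
exact: eqP.
Qed.

Lemma mk_graph_subproof n (r : rel 'I_n) :
  simple_adj [ffun u => [ffun v => (u != v) && (r u v || r v u)]].
Proof.
apply/andP; split; first by apply/forallP => u; rewrite !ffunE eqxx.
by apply/forallP => u; apply/forallP => v; rewrite !ffunE [v == u]eq_sym [r v u || _]orbC.
Qed.

(* The simple graph underlying an arbitrary relation; its adjacency is [r]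
   itself when [r] is irreflexive and symmetric. *)
Definition mk_graph n (r : rel 'I_n) : graph :=
  Tagged graph_on (GraphOn (mk_graph_subproof r)).

(* The subgraph induced on [A], relabelled on ['I_#|A|]. *)
Definition induced (G : graph) (A : {set vertex G}) : graph :=
  mk_graph (fun i j : 'I_#|A| => adj (enum_val i) (enum_val j)).

Lemma adj_induced (G : graph) (A : {set vertex G}) (i j : vertex (induced A)) :
  adj i j = adj (enum_val (i : 'I_#|A|)) (enum_val (j : 'I_#|A|)).
Proof.
rewrite {1}/adj /= !ffunE [adj (enum_val j) _]adj_sym orbb.
by case: eqVneq => //= ->; rewrite adj_irr.
Qed.

Definition isomorphic (G H : graph) : Prop :=
  exists2 f : vertex G -> vertex H,
    bijective f & forall u v, adj (f u) (f v) = adj u v.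

Definition isob (G H : graph) : bool := `[< isomorphic G H >].

Lemma isob_refl : reflexive isob.
Proof. by move=> G; apply/asboolP; exists id => //; exists id. Qed.

Lemma isob_imp_sym (G H : graph) : isob G H -> isob H G.
Proof.
move=> /asboolP[f [g fK gK] fadj]; apply/asboolP; exists g; first by exists f.
by move=> u v; rewrite -fadj !gK.
Qed.

Lemma isob_sym : symmetric isob.
Proof. by move=> G H; apply/idP/idP; apply: isob_imp_sym. Qed.

Lemma isob_trans : transitive isob.
Proof.
move=> H G K /asboolP[f fbij fadj] /asboolP[g gbij gadj].
apply/asboolP; exists (g \o f); first exact: bij_comp.
by move=> u v /=; rewrite gadj fadj.
Qed.

Canonical iso_equiv := EquivRel isob isob_refl isob_sym isob_trans.

(* Graphs up to isomorphism. *)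
Definition unlabeled := {eq_quot iso_equiv}%qT.

Definition iso_class (G : graph) : unlabeled := (\pi_({eq_quot iso_equiv}) G)%qT.

Lemma iso_classP (G H : graph) :
  iso_class G = iso_class H <-> isomorphic G H.
Proof.
split=> [/eqP|iGH]; first by rewrite eqmodE => /asboolP.
by apply/eqP; rewrite eqmodE; apply/asboolP.
Qed.

Definition degree (G : graph) (u : vertex G) : nat := #|[set v | adj u v]|.

Definition degree_sequence (G : graph) : seq nat :=
  sort geq [seq degree u | u : vertex G].

Definition realization (d : seq nat) (G : graph) : Prop :=
  degree_sequence G = d.

Local Open Scope classical_set_scope.

Definition is_free (F : set unlabeled) (G : graph) : Prop :=
  forall A : {set vertex G}, ~ F (iso_class (induced A)).

Definition DSF (F : set unlabeled) : Prop :=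
  forall d : seq nat,
    (exists2 G, realization d G & is_free F G) ->
    forall H, realization d H -> is_free F H.

(* The empty set satisfies [DSF] vacuously, so minimality is taken among
   nonempty sets; otherwise no nonempty set would be minimal. *)
Definition minimal_DSF (F : set unlabeled) : Prop :=
  [/\ F !=set0, DSF F &
      forall F' : set unlabeled, F' !=set0 -> F' `<` F -> ~ DSF F'].

(* Main.v *)
Require Import Defs.
From mathcomp Require Import all_boot all_order all_algebra.
From mathcomp Require Import boolp classical_sets cardinality reals.
From mathcomp Require Import generic_quotient perm zify lra.
From mathcomp Require Import fintype finset.

(**
Realizations of a degree sequence are connected by 2-switches, and a switch
that destroys an induced copy of [G] can be seen on at most two vertices
outside the copy. Hence, if [F] is a minimal DSF set and [S] a nonempty proper
subset, some [G] in [S] is linked to some [H] in [F] outside [S] by two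
realizations of one degree sequence on at most [|G| + 2] vertices, the first
containing [G] and the second [H]. Then [|H| <= |G| + 2] and
[e(H) <= e(G) + 2 |G| + 1]. With [m] the least order of a member of [F], all
orders are at most [m + 2 (k - 1)], and their sum is at most
[k m + k (k - 1)].

Adding to [G] a perfect matching on its darts gives the degree sequence of a
forest of stars, so [F] contains some [a] with at most [|a| - 1] edges, and,
taking complements, some [b] with at most [|b| - 1] non-edges. Following links
from [a] to [b], or from [b] to [a] in the complements if [|b| < |a|], yields
[m^2 - (4 k + 1) m - 4 k^2 + 8 <= 0] unless [m <= 2 k], whence the bound.
*)

Set Implicit Arguments.
Unset Strict Implicit.
Unset Printing Implicit Defensive.

(** * Switches *)

Section SimpleRelations.
Variable T : finType.
Implicit Types (e : rel T) (a b c d u v w x y : T) (P : {set T}).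

Definition simple_rel e := irreflexive e /\ symmetric e.
Definition nbrs e u : {set T} := [set v | e u v].
Definition same_degrees e e' := forall u, #|nbrs e u| = #|nbrs e' u|.
(* Edges are counted as ordered pairs, hence twice. *)
Definition ndarts e := #|[set p : T * T | e p.1 p.2]|.
Definition compl_rel e : rel T := [rel u v | (u != v) && ~~ e u v].

Lemma ndartsE e : ndarts e = \sum_u #|nbrs e u|.
Proof.
rewrite /ndarts -sum1_card.
under [RHS]eq_bigr do rewrite -sum1_card.
by rewrite pair_big_dep; apply: eq_bigl => p; rewrite !inE.
Qed.

Lemma eq_ndarts e e' : same_degrees e e' -> ndarts e = ndarts e'.
Proof. by move=> h; rewrite !ndartsE; apply: eq_bigr. Qed.

Lemma simple_compl e : simple_rel e -> simple_rel (compl_rel e).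
Proof.
move=> [_ sy]; split=> [u|u v]; rewrite /compl_rel /= ?eqxx //.
by rewrite eq_sym sy.
Qed.

Lemma nbrs_compl e u : simple_rel e -> (#|nbrs e u| + #|nbrs (compl_rel e) u|).+1 = #|T|.
Proof.
move=> [ir _].
have -> : nbrs (compl_rel e) u = ~: (u |: nbrs e u).
  by apply/setP => v; rewrite !inE negb_or eq_sym.
have := cardsC (u |: nbrs e u); rewrite cardsU1 !inE ir /=; lia.
Qed.

Lemma same_degrees_compl e e' : simple_rel e -> simple_rel e' ->
  same_degrees e e' -> same_degrees (compl_rel e) (compl_rel e').
Proof. by move=> s s' h u; have := nbrs_compl u s; have := nbrs_compl u s'; have := h u; lia. Qed.

Lemma ndarts_compl e : simple_rel e -> ndarts e + ndarts (compl_rel e) = #|T| * #|T|.-1.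
Proof.
move=> se; rewrite !ndartsE -big_split /= -sum_nat_const.
by apply: eq_bigr => u _; rewrite -(nbrs_compl u se).
Qed.

Definition switched a b c d e : rel T := fun u v =>
  let is_pair x y := (u == x) && (v == y) || (u == y) && (v == x) in
  if is_pair a b || is_pair c d then false
  else if is_pair a d || is_pair b c then true else e u v.

Definition switch e e' := exists a b c d,
  [/\ uniq [:: a; b; c; d], e a b && e c d, ~~ e a d && ~~ e b c
    & e' =2 switched a b c d e].

(** Both orientations of all six inequalities form one multirule, which settles every comparison in
    the case analyses below. *)
Lemma uniq4_neq a b c d : uniq [:: a; b; c; d] ->
  ((((a == b) = false) * ((b == a) = false) * ((a == c) = false)
  * ((c == a) = false) * ((a == d) = false) * ((d == a) = false))
  * (((b == c) = false) * ((c == b) = false) * ((b == d) = false)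
  * ((d == b) = false) * ((c == d) = false) * ((d == c) = false)))%type.
Proof.
rewrite /= !inE !negb_or -!andbA !andbT.
move=> /and5P[/negPf ab /negPf ac /negPf ad /negPf bc /andP[/negPf bd /negPf cd]].
by do ![split => //]; rewrite eq_sym.
Qed.

Lemma switch_simple e e' : simple_rel e -> switch e e' -> simple_rel e'.
Proof.
move=> [ir sy] [a [b [c [d [/uniq4_neq N _ _ E]]]]].
split=> [u|u v].
  rewrite E /switched ir.
  case: (eqVneq u a) => [->|_]; first by rewrite !N.
  case: (eqVneq u b) => [->|_]; first by rewrite !N.
  case: (eqVneq u c) => [->|_]; first by rewrite !N.
  by rewrite !andbF.
have C x y : (u == x) && (v == y) || (u == y) && (v == x)
           = (v == x) && (u == y) || (v == y) && (u == x).
  by rewrite orbC andbC [_ && (v == y)]andbC.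
by rewrite !E /switched sy !C.
Qed.

(* Around [a] and [c] the switch exchanges [b] and [d], around [b] and [d] it
   exchanges [a] and [c]. *)
Lemma switch_degrees e e' : simple_rel e -> switch e e' -> same_degrees e e'.
Proof.
move=> [ir sy] [a [b [c [d [/uniq4_neq N /andP[eab ecd] /andP[/negPf ead /negPf ebc] E]]]]] u.
have [p Hp] : exists p : {perm T}, forall v, e' u v = e u (p v).
  have [/orP ua|ua] := boolP ((u == a) || (u == c)).
    exists (tperm b d) => v; rewrite E /switched.
    case: ua => /eqP ->; case: tpermP => [->|->|/eqP/negPf nb /eqP/negPf nd];
      by rewrite ?nb ?nd ?eqxx ?N //= ?ead ?ecd ?eab 1?[e c b]sy ?ebc.
  move: ua; rewrite negb_or => /andP[/negPf ua /negPf uc].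
  have [/orP ub|ub] := boolP ((u == b) || (u == d)).
    exists (tperm a c) => v; rewrite E /switched.
    case: ub => /eqP ->; case: tpermP => [->|->|/eqP/negPf na /eqP/negPf nc];
      by rewrite ?na ?nc ?eqxx ?N //= ?[e _ a]sy ?[e d c]sy ?ead ?ecd ?eab ?ebc.
  move: ub; rewrite negb_or => /andP[/negPf ub /negPf ud].
  by exists 1%g => v; rewrite perm1 E /switched ua ub uc ud.
rewrite -(card_preimset (nbrs e u) (@perm_inj _ p)).
by apply: eq_card => v; rewrite !inE Hp.
Qed.

Lemma switch_sym e e' : simple_rel e -> switch e e' -> switch e' e.
Proof.
move=> [ir sy] [a [b [c [d [un /andP[eab ecd] /andP[/negPf ead /negPf ebc] E]]]]].
have N := uniq4_neq un.
(* Exchanging the roles of [b] and [d] removes the added edges and restores the removed ones. *)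
exists a, d, c, b; split.
- by rewrite /= !inE !N.
- by rewrite !E /switched !eqxx !N.
- by rewrite !E /switched !eqxx !N.
move=> u v; rewrite /switched E /switched.
have D z : [\/ z = a, z = b, z = c | z = d \/
    (((z == a) = false) * ((z == b) = false) * ((z == c) = false) * ((z == d) = false))%type].
  case: (eqVneq z a) => [->|_]; first by constructor 1.
  case: (eqVneq z b) => [->|_]; first by constructor 2.
  case: (eqVneq z c) => [->|_]; first by constructor 3.
  by constructor 4; case: (eqVneq z d) => [->|_]; [left|right].
case: (D u) => [->|->|->|[->|Nu]]; case: (D v) => [->|->|->|[->|Nv]];
  rewrite ?Nu ?Nv ?eqxx ?N //= ?ir ?eab ?ecd ?ead ?ebc //;
  by rewrite sy ?ir ?eab ?ecd ?ead ?ebc.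
Qed.

(* [P] is the set of vertices whose neighbourhood is to be left untouched. *)
Lemma switch_toward P e v x y : simple_rel e ->
  v \notin P -> x \notin P -> y \notin P -> e v x -> ~~ e v y -> y != v ->
  #|nbrs e x :\: P| <= #|nbrs e y :\: P| ->
  exists e', [/\ switch e e', nbrs e' v = y |: (nbrs e v :\ x)
    & forall u, u \in P -> nbrs e' u = nbrs e u].
Proof.
move=> [ir sy] vP xP yP vx vy yv le.
have xy : x != y by apply: contraNneq vy => <-.
have xv : x != v by apply: contraTneq vx => ->; rewrite ir.
pose A := (nbrs e x :\: P) :\ y; pose B := (nbrs e y :\: P) :\ x.
(* The two cardinalities drop equally, by one exactly when [x] and [y] are adjacent. *)
have leAB : #|A| <= #|B|.
  move: le; rewrite (cardsD1 y (nbrs e x :\: P)) (cardsD1 x (nbrs e y :\: P)).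
  by rewrite !inE xP yP sy leq_add2l.
(* Since [v] lies in [A] but not in [B], an inclusion of [B] in [A] would be strict. The resulting
   [w] is the fourth vertex of the switch. *)
have [w wB wA] : exists2 w, w \in B & w \notin A.
  apply/subsetPn; apply: contraTN leAB => sBA.
  rewrite -ltnNge; apply: proper_card; rewrite properE sBA /=.
  by apply/subsetPn; exists v; rewrite !inE ?[e _ v]sy ?vx ?vP
    ?[v == _]eq_sym ?yv ?(negPf vy) ?andbF.
move: wB wA; rewrite !inE => /and3P[wx wP yw].
have wy : w != y by apply: contraTneq yw => ->; rewrite ir.
rewrite wy wP /= => xw.
have wv : w != v by apply: contraTneq yw => ->; rewrite sy.
have un : uniq [:: v; x; w; y].
  by rewrite /= !inE ![v == _]eq_sym [x == w]eq_sym !negb_or xv wv yv wx xy wy.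
exists (switched v x w y e); split.
- by exists v, x, w, y; split; rewrite ?vx ?vy ?xw ?[e w y]sy ?yw.
- apply/setP => u; rewrite !inE /switched eqxx !(uniq4_neq un) /= !orbF.
  by case: (eqVneq u x) => [->|_] /=; [rewrite (negPf xy)|case: eqVneq].
- move=> u uP; apply/setP => t; rewrite !inE /switched.
  have H z : z \notin P -> (u == z) = false by move=> zP; apply: contraNF zP => /eqP <-.
  by rewrite !H.
Qed.

(* Neighbourhoods are made to agree one vertex at a time; whether to switch in
   the source or in the target is decided by comparing degrees outside the
   vertices already treated. *)
Lemma switch_invariant (Q : rel T -> Prop) :
  (forall e e', simple_rel e -> simple_rel e' -> switch e e' -> Q e -> Q e') ->
  forall e1 e2, simple_rel e1 -> simple_rel e2 -> same_degrees e1 e2 ->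
  Q e1 -> Q e2.
Proof.
move=> Qsw e1 e2.
have: forall u, u \in @set0 T -> nbrs e1 u = nbrs e2 u by move=> u; rewrite inE.
have [n] := ubnP #|~: @set0 T|; move: (set0 : {set T}) => P.
elim: n P e1 e2 => // n IHn P e1 e2 ltn agree s1 s2 deg.
have [v vP|all_in] := pickP (fun v => v \notin P); last first.
  suff -> : e1 = e2 by [].
  apply/funext => u; apply/funext => v.
  have /agree/setP/(_ v) : u \in P by have /negbFE := all_in u.
  by rewrite !inE.
have [k] := ubnP #|nbrs e1 v :\: nbrs e2 v|.
elim: k e1 e2 agree s1 s2 deg => // k IHk e1 e2 agree s1 s2 deg ltk.
have [|[x]] := set_0Vmem (nbrs e1 v :\: nbrs e2 v).
  move=> /eqP; rewrite setD_eq0 => sub.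
  have Ev : nbrs e1 v = nbrs e2 v by apply/eqP; rewrite eqEcard sub deg leqnn.
  apply: (IHn (v |: P)) => //.
    have := cardsC P; have := cardsC (v |: P).
    rewrite cardsU1 vP -[_ < n.+1]/(_ <= n) in ltn *; lia.
  by move=> u; rewrite !inE => /orP[/eqP->|/agree].
rewrite !inE => /andP[vx2 vx1].
have [y yD] : exists y, y \in nbrs e2 v :\: nbrs e1 v.
  apply/set0Pn; rewrite -card_gt0.
  have := cardsID (nbrs e2 v) (nbrs e1 v); have := cardsID (nbrs e1 v) (nbrs e2 v).
  rewrite setIC -(deg v) => <-.
  have : 0 < #|nbrs e1 v :\: nbrs e2 v|.
    by rewrite card_gt0; apply/set0Pn; exists x; rewrite !inE vx1 vx2.
  lia.
move: yD; rewrite !inE => /andP[vy1 vy2].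
have [ir1 sy1] := s1; have [ir2 sy2] := s2.
(* By symmetry, treated vertices already have the same adjacency to [v] in both relations. *)
have outP z : e1 v z != e2 v z -> z \notin P.
  by apply: contraNN => /agree/setP/(_ v); rewrite !inE sy1 sy2 => ->.
have xP : x \notin P by apply: outP; rewrite vx1 (negPf vx2).
have yP : y \notin P by apply: outP; rewrite vy2 (negPf vy1).
have degP z : #|nbrs e1 z :\: P| = #|nbrs e2 z :\: P|.
  have := cardsID P (nbrs e1 z); have := cardsID P (nbrs e2 z); rewrite (deg z).
  suff -> : nbrs e1 z :&: P = nbrs e2 z :&: P by lia.
  apply/setP => u; rewrite !inE; case uP: (u \in P); rewrite ?andbF // !andbT.
  by have /setP/(_ z) := agree u uP; rewrite !inE sy1 sy2.
have yv : y != v by apply: contraTneq vy2 => ->; rewrite ir2.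
have xv : x != v by apply: contraTneq vx1 => ->; rewrite ir1.
have smaller (A : {set T}) : A \subset (nbrs e1 v :\: nbrs e2 v) :\ x -> #|A| < k.
  move=> /subset_leq_card leA; apply: leq_ltn_trans leA _.
  by move: ltk; rewrite (cardsD1 x) !inE vx1 vx2.
(* Either [e1] trades the neighbour [x] of [v] for [y], or [e2] trades [y] for [x]; both remove [x]
   from the difference. In the second case [Q] is carried back to [e2] by the reverse switch. *)
have [le|/ltnW le] := leqP #|nbrs e1 x :\: P| #|nbrs e1 y :\: P|.
  have [e' [sw Nv NP]] := switch_toward s1 vP xP yP vx1 vy1 yv le.
  have s' := switch_simple s1 sw.
  move=> Q1; apply: (IHk e') (Qsw _ _ s1 s' sw Q1) => //.
  - by move=> u uP; rewrite NP // agree.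
  - by move=> u; rewrite -(switch_degrees s1 sw).
  apply: smaller; apply/subsetP => u; rewrite Nv !inE.
  by case: (eqVneq u y) => [->|_] /=; [rewrite vy2|case: (u == x) => //=; rewrite ?andbF].
rewrite !degP in le.
have [e' [sw Nv NP]] := switch_toward s2 vP yP xP vy2 vx2 xv le.
have s' := switch_simple s2 sw.
move=> Q1; apply: (Qsw e') (switch_sym s2 sw) _ => //; apply: (IHk e1) Q1 => //.
- by move=> u uP; rewrite NP // agree.
- by move=> u; rewrite deg (switch_degrees s2 sw).
apply: smaller; apply/subsetP => u; rewrite Nv !inE.
case: (eqVneq u x) => [->|_] //=.
by case: (eqVneq u y) => [->|_] //=; rewrite (negPf vy1) ?andbF.
Qed.

End SimpleRelations.

(** * Induced copies and links *)

(** The host lives on any finite type, so that sums and subtypes need no relabelling to ordinals. *)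
Definition contains (G : graph) (T : finType) (e : rel T) :=
  exists2 f : vertex G -> T, injective f & forall u v, e (f u) (f v) = adj u v.

Definition compl_graph (G : graph) : graph := mk_graph (fun u v : vertex G => ~~ adj u v).

Lemma adj_simple (G : graph) : simple_rel (@adj G).
Proof. by split=> [u|u v]; [apply: adj_irr|apply: adj_sym]. Qed.

Lemma adj_compl (G : graph) (u v : vertex G) :
  @adj (compl_graph G) u v = compl_rel (@adj G) u v.
Proof. by rewrite {1}/adj /= !ffunE [adj v u]adj_sym orbb. Qed.

Lemma ndarts_compl_graph (G : graph) :
  ndarts (@adj G) + ndarts (@adj (compl_graph G)) = num_vertices G * (num_vertices G).-1.
Proof.
rewrite -[num_vertices G]card_ord -(ndarts_compl (adj_simple G)).
by congr (_ + _); apply: eq_card => p; rewrite !inE; apply: adj_compl.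
Qed.

Lemma contains_compl (G : graph) (T : finType) (e : rel T) :
  contains G e -> contains (compl_graph G) (compl_rel e).
Proof.
case=> f fi fe; exists f => // u v.
by rewrite adj_compl /compl_rel /= fe (inj_eq fi).
Qed.

Lemma contains_of_compl (G : graph) (T : finType) (e : rel T) : simple_rel e ->
  contains (compl_graph G) e -> contains G (compl_rel e).
Proof.
move=> [ir sy] [f fi fe]; exists f => // u v.
rewrite /compl_rel /= (inj_eq fi) fe adj_compl /compl_rel /= negb_and !negbK.
by case: eqVneq => //= ->; rewrite adj_irr.
Qed.

Lemma compl_relK (T : finType) (e : rel T) : simple_rel e -> compl_rel (compl_rel e) = e.
Proof.
move=> [ir _]; apply/funext => u; apply/funext => v.
by rewrite /compl_rel /= negb_and !negbK; case: eqVneq => //= ->; rewrite ir.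
Qed.

Lemma contains_card (G : graph) (T : finType) (e : rel T) :
  contains G e -> num_vertices G <= #|T|.
Proof. by case=> f fi _; have := leq_card f fi; rewrite card_ord. Qed.

Lemma contains_ndarts (G : graph) (T : finType) (e : rel T) :
  contains G e -> ndarts (@adj G) <= ndarts e.
Proof.
case=> f fi fe; pose g (p : vertex G * vertex G) := (f p.1, f p.2).
have gi : injective g by move=> [a b] [c d] [/fi-> /fi->].
rewrite /ndarts -(card_imset _ gi); apply: subset_leq_card.
by apply/subsetP => q /imsetP[p]; rewrite !inE => ep ->; rewrite /= fe.
Qed.

(* The bound [+ 2] is what a single switch disturbing a copy of [G] allows. *)
Definition linked (G H : graph) := exists (T : finType) (e1 e2 : rel T),
  [/\ simple_rel e1 /\ simple_rel e2, same_degrees e1 e2,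
      #|T| <= num_vertices G + 2, contains G e1 & contains H e2].

Lemma linked_vertices (G H : graph) : linked G H -> num_vertices H <= num_vertices G + 2.
Proof. by case=> T [e1 [e2 [_ _ le _ /contains_card]]]; move/leq_trans; apply. Qed.

(** The non-edges of [G] survive in the first host. With [n] the order of [G], that host has at most
    [(n + 2) * (n + 1) - n * (n - 1) = 4 * n + 2] darts more than [G], and the second host has
    equally many darts. *)
Lemma linked_ndarts (G H : graph) : linked G H ->
  ndarts (@adj H) <= ndarts (@adj G) + (4 * num_vertices G + 2).
Proof.
case=> T [e1 [e2 [[s1 s2] deg le cG cH]]].
have := contains_ndarts cH; rewrite -(eq_ndarts deg).
have := contains_ndarts (contains_compl cG).
have := ndarts_compl s1; have := ndarts_compl_graph G.
have : #|T| * #|T|.-1 <= (num_vertices G + 2) * (num_vertices G + 1).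
  by apply: leq_mul => //; lia.
by case: (num_vertices G) => [|n] /=; nia.
Qed.

Lemma linked_compl (G H : graph) : linked G H -> linked (compl_graph G) (compl_graph H).
Proof.
case=> T [e1 [e2 [[s1 s2] deg le cG cH]]].
exists T, (compl_rel e1), (compl_rel e2); split=> //; try exact: contains_compl.
- by split; apply: simple_compl.
- exact: same_degrees_compl.
Qed.

Lemma card_setU4 (T : finType) (A : {set T}) a b c d : a \in A -> b \in A ->
  #|A :|: [set a; b; c; d]| <= #|A| + 2.
Proof.
move=> aA bA.
have -> : A :|: [set a; b; c; d] = A :|: [set c; d].
  by apply/setP => x; rewrite !inE; do 2 case: eqVneq => [->|_]; rewrite ?aA ?bA.
by apply: leq_trans (leq_card_setU _ _) _; rewrite leq_add2l cards2; case: eqP.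
Qed.

Section Family.
Variables (I : finType) (gs : I -> graph).

(** The contrapositive form of [DSF], for a subfamily and for hosts on any finite type. *)
Definition forcing (S : {set I}) := forall (T : finType) (e1 e2 : rel T),
  simple_rel e1 -> simple_rel e2 -> same_degrees e1 e2 ->
  forall i, i \in S -> contains (gs i) e1 -> exists2 j, j \in S & contains (gs j) e2.

(* A switch destroying a copy of [gs i] changes a pair inside that copy, hence
   meets it in two vertices, and may be observed on the copy together with the
   at most two further vertices of the switch. *)
Lemma linked_leaving (S : {set I}) : forcing setT -> ~ forcing S ->
  exists i l, [/\ i \in S, l \notin S & linked (gs i) (gs l)].
Proof.
move=> forT nforS; apply: contrapT => noarc; apply: nforS => T e1 e2 s1 s2 deg i iS ci.
have : exists2 j, j \in S & contains (gs j) e1 by exists i.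
move: e1 e2 s1 s2 deg {ci}.
apply: (@switch_invariant _ (fun e => exists2 j, j \in S & contains (gs j) e)).
move=> e e' se se' sw {i iS} [i iS [f fi fe]].
have [/forallP ok|] := boolP [forall u, forall v, e' (f u) (f v) == adj u v].
  by exists i => //; exists f => // u v; have /forallP/(_ v)/eqP := ok u.
rewrite negb_forall => /existsP[u]; rewrite negb_forall => /existsP[v uv].
have [a [b [c [d [un e_in e_out E]]]]] := sw.
pose A := f @: setT; pose U := A :|: [set a; b; c; d].
have cU : #|U| <= num_vertices (gs i) + 2.
  have cA : #|A| = num_vertices (gs i) by rewrite card_imset // cardsT card_ord.
  have fA w : f w \in A by apply: imset_f.
  (* The pair [u], [v] whose adjacency changed is mapped to one of the four pairs altered by the
     switch. *)
  have : [|| (a \in A) && (b \in A), (c \in A) && (d \in A),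
     (a \in A) && (d \in A) | (b \in A) && (c \in A)].
    apply: contraR uv; rewrite !negb_or => /and4P[ab cd ad bc].
    have K x y : ~~ ((x \in A) && (y \in A)) ->
        (f u == x) && (f v == y) || (f u == y) && (f v == x) = false.
      by apply: contraNF => /orP[] /andP[/eqP <- /eqP <-]; rewrite !fA.
    by rewrite E /switched !K // fe.
  rewrite -cA => /or4P[] /andP[h1 h2].
  - exact: card_setU4.
  - have <- : A :|: [set c; d; a; b] = U by apply/setP => x; rewrite !inE; do !case: eqP.
    exact: card_setU4.
  - have <- : A :|: [set a; d; b; c] = U by apply/setP => x; rewrite !inE; do !case: eqP.
    exact: card_setU4.
  - have <- : A :|: [set b; c; a; d] = U by apply/setP => x; rewrite !inE; do !case: eqP.
    exact: card_setU4.
pose V := {x : T | x \in U}.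
pose r : rel V := relpre val e; pose r' : rel V := relpre val e'.
have sr : simple_rel r by case: se => ir sy; split=> [x|x y]; [apply: ir|apply: sy].
have fU w : f w \in U by rewrite inE imset_f.
have [aU bU cdU dU] : [/\ a \in U, b \in U, c \in U & d \in U].
  by rewrite !inE !eqxx !orbT.
have swr : switch r r'.
  exists (Sub a aU), (Sub b bU), (Sub c cdU), (Sub d dU).
  split=> // x y; rewrite /r' /= E /switched /r /= -!val_eqE //=.
have ci : contains (gs i) r.
  exists (fun w => Sub (f w) (fU w) : V) => [w w' [/fi]|w w'] //; exact: fe.
have [l _ cl] := forT _ _ _ sr (switch_simple sr swr) (switch_degrees sr swr) i (in_setT i) ci.
(* A member of [S] found on [U] also lies in [e']; a member outside [S] would give a link leaving
   [S]. *)
have [lS|lS] := boolP (l \in S).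
  exists l => //; case: cl => g gi ge; exists (val \o g) => //; exact: inj_comp val_inj gi.
case: noarc; exists i, l; split=> //; exists V, r, r'; split=> //.
- by split=> //; apply: switch_simple swr.
- exact: switch_degrees.
- by rewrite card_sig.
Qed.

End Family.

(** * Sparse members and the bound on the orders *)

Section StarForest.
Variable G : graph.

(* Pairs [(u, v)] that are not edges of [G] are isolated vertices in both
   graphs. *)
Let darts_added : finType := (vertex G + vertex G * vertex G)%type.

Definition with_matching : rel darts_added := fun x y =>
  match x, y with
  | inl u, inl v => adj u v
  | inr p, inr q => (q == (p.2, p.1)) && adj p.1 p.2
  | _, _ => false
  end.

(** The centres are the vertices of [G], and the leaves at [u] are the darts leaving [u]. Centres
    thus keep their degree in [G], and leaves have degree one, as in the matching. *)
Definition star_forest : rel darts_added := fun x y =>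
  match x, y with
  | inl u, inr p | inr p, inl u => (p.1 == u) && adj p.1 p.2
  | _, _ => false
  end.

Lemma with_matching_simple : simple_rel with_matching.
Proof.
split=> [[u|[u v]]|[u|[u v]] [w|[w z]]] //=; rewrite ?adj_irr 1?adj_sym //.
  by case: eqP => // -[->]; rewrite adj_irr.
rewrite !xpair_eqE [adj v u]adj_sym.
by case: (eqVneq w v) => [->|_] /=; case: (eqVneq z u) => [->|_]; rewrite ?andbF ?eqxx //= adj_sym.
Qed.

Lemma star_forest_simple : simple_rel star_forest.
Proof. by split=> [[u|p]|[u|p] [v|q]]. Qed.

Lemma star_forest_degrees : same_degrees with_matching star_forest.
Proof.
have inl_inj : injective (@inl (vertex G) (vertex G * vertex G)) by move=> ? ? [].
move=> [u|[u v]].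
  have -> : nbrs with_matching (inl u) = inl @: [set v | adj u v].
    apply/setP => -[w|p]; rewrite !inE /=.
      by rewrite (mem_imset _ _ inl_inj) inE.
    by apply/esym/negP => /imsetP[].
  have -> : nbrs star_forest (inl u) = (fun v => inr (u, v)) @: [set v | adj u v].
    apply/setP => -[w|[w z]]; rewrite !inE /=.
      by apply/esym/negP => /imsetP[].
    apply/andP/imsetP => [[/eqP-> uz]|[t]]; first by exists z; rewrite ?inE.
    by rewrite inE => ut [-> ->].
  by rewrite !card_imset // => ? ? [].
case uv: (adj u v); last first.
  by apply: eq_card => -[w|[w z]]; rewrite !inE /= uv andbF.
have -> : nbrs with_matching (inr (u, v)) = [set inr (v, u)].
  by apply/setP => -[w|[w z]]; rewrite !inE //= uv andbT.
have -> : nbrs star_forest (inr (u, v)) = [set inl u].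
  by apply/setP => -[w|[w z]]; rewrite !inE //= uv andbT eq_sym.
by rewrite !cards1.
Qed.

Lemma contains_with_matching : contains G with_matching.
Proof. by exists inl => // u v []. Qed.

(** Each edge joins a centre to a leaf and is determined by its leaf. As soon as there is an edge,
    some vertex is a centre, so the leaves number at most one less than the order. *)
Lemma star_forest_ndarts (H : graph) :
  contains H star_forest -> ndarts (@adj H) <= 2 * (num_vertices H).-1.
Proof.
case=> f fi fe.
pose D b := [set p : vertex H * vertex H | adj p.1 p.2 & is_inl (f p.1) == b].
have -> : ndarts (@adj H) = #|D true| + #|D false|.
  rewrite /ndarts -(cardsID [set p | is_inl (f p.1)]).
  by congr (_ + _); apply: eq_card => p; rewrite !inE ?eqb_id ?eqbF_neg // andbC.
(* Reversing a dart exchanges those starting at a centre with those starting at a leaf. *)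
have -> : #|D false| = #|D true|.
  have swi : injective (fun p : vertex H * vertex H => (p.2, p.1)).
    by move=> [? ?] [? ?] [-> ->].
  rewrite -(card_preimset _ swi); apply: eq_card => -[x y].
  rewrite !inE /= [adj y x]adj_sym -!fe.
  by case: (f x) (f y) => [u|p] [v|q]; rewrite /= ?andbF ?andbT.
rewrite addnn -mul2n leq_mul2l /=.
pose Y := [set y | ~~ is_inl (f y)].
have leY : #|D true| <= #|Y|.
  have inj2 : {in D true &, injective (fun p : vertex H * vertex H => p.2)}.
    move=> [x y] [x' y']; rewrite !inE /= -!fe => /andP[h1 h2] /andP[h1' h2'] E.
    move: h1 h2 h1' h2'; rewrite -E.
    case fx: (f x) => [u|//]; case fx': (f x') => [u'|//].
    case: (f y) => //= p /andP[/eqP up _] _ /andP[/eqP up' _] _.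
    by congr pair; apply: fi; rewrite fx fx' -up -up'.
  rewrite -(card_in_imset inj2); apply: subset_leq_card.
  apply/subsetP => _ /imsetP[[x y] + ->]; rewrite !inE /= -fe.
  by case: (f x) (f y) => [u|p] [v|q] //=; rewrite andbF.
have [->|[[x y]]] := set_0Vmem (D true); first by rewrite cards0.
rewrite inE /= => /andP[_ /eqP xl].
have : x \notin Y by rewrite inE xl.
have := cardsC Y; rewrite card_ord -[x \notin Y]in_setC => <- xY.
have : 0 < #|~: Y| by rewrite card_gt0; apply/set0Pn; exists x.
by case: #|~: Y| => // n _; rewrite addnS /=; apply: leq_trans leY (leq_addr _ _).
Qed.
End StarForest.

(** * Orders and edge counts along chains of links *)

Section Bounds.
Variables (I : finType) (gs : I -> graph).
Notation nv i := (num_vertices (gs i)).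
Notation nd i := (ndarts (@adj (gs i))).

Lemma forest_member : forcing gs setT -> I ->
  exists l, nd l <= 2 * (nv l).-1.
Proof.
move=> forT i.
have [l _ /star_forest_ndarts] := forT _ _ _ (with_matching_simple _) (star_forest_simple _)
  (@star_forest_degrees (gs i)) i (in_setT i) (contains_with_matching _).
by exists l.
Qed.

Lemma forcing_compl : forcing gs setT -> forcing (fun i => compl_graph (gs i)) setT.
Proof.
move=> forT T e1 e2 s1 s2 deg i _ /(contains_of_compl s1) ci.
have [j _ cj] := forT _ _ _ (simple_compl s1) (simple_compl s2)
  (same_degrees_compl s1 s2 deg) i (in_setT i) ci.
by exists j => //; rewrite -(compl_relK s2); apply: contains_compl.
Qed.

Lemma path_ndarts x p : path (fun i j => `[< linked (gs i) (gs j) >]) x p ->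
  nd (last x p) <= nd x + \sum_(y <- belast x p) (4 * nv y + 2).
Proof.
elim: p x => [|y p IHp] x /=; first by rewrite big_nil addn0.
move=> /andP[/asboolP/linked_ndarts xy /IHp]; rewrite big_cons; lia.
Qed.

Hypothesis linked_out : forall S : {set I}, S != set0 -> S != setT ->
  exists i l, [/\ i \in S, l \notin S & linked (gs i) (gs l)].

(** No link leaves the set of members reachable from [i], so this set is everything. *)
Lemma linked_connected i j : connect (fun i j => `[< linked (gs i) (gs j) >]) i j.
Proof.
pose S := [set l | connect (fun i j => `[< linked (gs i) (gs j) >]) i l].
suff : j \in S by rewrite inE.
have [->|ST] := eqVneq S setT; first by rewrite inE.
have S0 : S != set0 by apply/set0Pn; exists i; rewrite inE connect0.
have [x [l [xS lS xl]]] := linked_out S0 ST.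
case/negP: lS; rewrite inE in xS; rewrite inE; apply: connect_trans xS (connect1 _).
exact/asboolP.
Qed.

(** Along a path without repetition each member is charged at most once, for the link leaving it,
    and the endpoint [j] is not charged. *)
Lemma connected_ndarts i j : nd j <= nd i + \sum_(y | y != j) (4 * nv y + 2).
Proof.
have /connectP[p0 ph ->] := linked_connected i j.
case/shortenP: ph => p ph up _.
apply: leq_trans (path_ndarts ph) _; rewrite leq_add2l.
move: up; rewrite lastI rcons_uniq => /andP[lp up].
rewrite big_uniq // [leqRHS](bigID (mem (belast i p))) /=.
apply: leq_trans (leq_addr _ _); rewrite leq_eqVlt; apply/orP; left; apply/eqP.
apply: eq_bigl => y; case yp: (y \in belast i p); rewrite ?andbF // andbT.
by apply/esym; apply: contraNneq lp => <-.
Qed.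

Variable i0 : I.

(** Each link leaving the current set adds a member with at most two vertices more than the largest
    so far; the excesses [0, 2, ..., 2 * t] sum to [t * t.+1]. *)
Lemma grow_family t : t < #|I| -> exists A : {set I},
  [/\ #|A| = t.+1, \sum_(i in A) nv i <= t.+1 * nv i0 + t * t.+1
    & forall i, i \in A -> nv i <= nv i0 + 2 * t].
Proof.
elim: t => [_|t IHt tI].
  exists [set i0]; rewrite cards1 big_set1; split=> // [|i]; first by lia.
  by rewrite inE => /eqP->; rewrite muln0 addn0.
have [A [cA sA mA]] := IHt (ltnW tI).
have A0 : A != set0 by rewrite -card_gt0 cA.
have AT : A != setT by apply: contraTneq tI => AT; rewrite -cardsT -AT cA -leqNgt.
have [i [l [iA lA /linked_vertices il]]] := linked_out A0 AT.
have := mA i iA => hi.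
exists (l |: A); split=> [||j].
- by rewrite cardsU1 lA cA.
- by rewrite big_setU1 //=; nia.
by rewrite !inE => /orP[/eqP->|/mA]; lia.
Qed.

Lemma sum_vertices k : #|I| = k.+1 ->
  \sum_i nv i <= k.+1 * nv i0 + k * k.+1 /\ forall i, nv i <= nv i0 + 2 * k.
Proof.
move=> cI; have [|A [cA sA mA]] := @grow_family k; first by rewrite cI.
have AT : A = setT by apply/eqP; rewrite eqEcard subsetT cardsT cI cA leqnn.
split=> [|i]; last by apply: mA; rewrite AT inE.
by move: sA; rewrite AT; under eq_bigl do rewrite inE.
Qed.

Lemma sum_other_vertices k j : (forall i, nv i0 <= nv i) -> #|I| = k.+1 ->
  \sum_(y | y != j) (4 * nv y + 2) <= 4 * (k * nv i0 + k * k.+1) + 2 * k.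
Proof.
move=> i0_min cI; have [le _] := sum_vertices cI.
rewrite big_split /= -big_distrr /= sum_nat_const.
have -> : #|[pred y | y != j]| = k.
  by have := cardC1 j; rewrite cI /= => <-; apply: eq_card.
move: le; rewrite (bigD1 j) //=; have := i0_min j; nia.
Qed.

End Bounds.

(** On integers from 2 on, [(x - 1) * (x - 4)] is nondecreasing; for [m <= 1] the left side
    vanishes. *)
Lemma quadratic_descent m n c : m <= n ->
  n * n.-1 <= 4 * n.-1 + c -> m * m.-1 <= 4 * m.-1 + c.
Proof. by case: m => [|[|m]] // /subnKC <- /=; nia. Qed.

Section MinimalFamily.
Variables (I : finType) (gs : I -> graph) (k : nat).
Notation nv i := (num_vertices (gs i)).
Hypothesis cI : #|I| = k.+1.
Hypothesis forT : forcing gs setT.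
Hypothesis linked_out : forall S : {set I}, S != set0 -> S != setT ->
  exists i l, [/\ i \in S, l \notin S & linked (gs i) (gs l)].

(* A sparse member [a] and a co-sparse member [b] are linked both ways; the
   count ends at the larger of the two, in the graph or in its complement. *)
Lemma min_vertices_bound (i0 : I) : (forall i, nv i0 <= nv i) ->
  nv i0 * (nv i0).-1 <= 4 * (nv i0).-1 + (4 * (k * nv i0 + k * k.+1) + 2 * k).
Proof.
move=> i0_min.
have linked_out' : forall S : {set I}, S != set0 -> S != setT ->
    exists i l, [/\ i \in S, l \notin S & linked (compl_graph (gs i)) (compl_graph (gs l))].
  by move=> S S0 /(linked_out S0)[i [l [? ? /linked_compl ?]]]; exists i, l.
have [a fa] := forest_member forT i0.
have [b fb] := forest_member (forcing_compl forT) i0.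
change (num_vertices (compl_graph (gs b))) with (nv b) in fb.
have [ab|/ltnW ba] := leqP (nv a) (nv b).
  (* With [n] the order of [b], the darts of [gs b] and of its complement total [n * n.-1]. The
     complement has at most [2 * n.-1], and [gs b] at most [2 * n.-1] plus the cost of the links
     from [a], as [a] is no larger. *)
  apply: quadratic_descent (i0_min b) _.
  have := connected_ndarts linked_out a b.
  have := sum_other_vertices linked_out b i0_min cI.
  have := ndarts_compl_graph (gs b); lia.
apply: quadratic_descent (i0_min a) _.
have := connected_ndarts linked_out' b a.
have := sum_other_vertices linked_out' a i0_min cI.
have := ndarts_compl_graph (gs a).
change (num_vertices (compl_graph ?G)) with (num_vertices G).
move: fa fb ba; lia.
Qed.
End MinimalFamily.

(** * Degree sequences and isomorphism classes *)

Lemma adj_mk_graph n (r : rel 'I_n) : simple_rel r -> @adj (mk_graph r) =2 r.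
Proof.
move=> [ir sy] u v; rewrite {1}/adj /= !ffunE [r v u]sy orbb.
by case: eqVneq => //= ->; rewrite ir.
Qed.

Lemma isomorphic_num_vertices (G H : graph) :
  isomorphic G H -> num_vertices G = num_vertices H.
Proof. by case=> f /bij_eq_card; rewrite !card_ord. Qed.

Lemma contains_induced (G H : graph) :
  contains G (@adj H) <-> exists A : {set vertex H}, iso_class (induced A) = iso_class G.
Proof.
split=> [[f fi fe]|[A /iso_classP[f [g fK gK] fe]]]; last first.
  exists (fun u => enum_val (g u : 'I_#|A|)) => [|u v].
    exact: inj_comp enum_val_inj (can_inj gK).
  by rewrite -adj_induced -fe !gK.
pose A := f @: setT; exists A; apply/esym/iso_classP.
have fA u : f u \in A by apply: imset_f.
pose h u : vertex (induced A) := enum_rank_in (fA u) (f u).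
have hK u : enum_val (h u : 'I_#|A|) = f u by apply: enum_rankK_in.
exists h => [|u v]; last by rewrite adj_induced !hK fe.
apply: inj_card_bij => [u v /(congr1 (fun x : 'I_#|A| => enum_val x))|].
  by rewrite !hK => /fi.
rewrite !card_ord; change (num_vertices (induced A)) with #|A|.
by rewrite card_imset // cardsT card_ord.
Qed.

Lemma contains_embed (G : graph) (T U : finType) (e : rel T) (e' : rel U) (h : T -> U) :
  injective h -> (forall x y, e' (h x) (h y) = e x y) -> contains G e -> contains G e'.
Proof.
move=> hi he [f fi fe]; exists (h \o f); first exact: inj_comp.
by move=> u v; rewrite /= he fe.
Qed.

Lemma perm_eq_reindex n m (f : 'I_n -> nat) (g : 'I_m -> nat) :
  perm_eq [seq g i | i : 'I_m] [seq f i | i : 'I_n] ->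
  exists2 h : 'I_m -> 'I_n, bijective h & f \o h =1 g.
Proof.
move=> fg; have mn : m = n by have := perm_size fg; rewrite !size_image !card_ord.
subst m; have /(@tuple_permP _ _ _ [tuple f i | i < n])[p E] := fg.
exists p; first by exists (p^-1)%g; [apply: permK|apply: permKV].
have /eq_in_map H : [seq g i | i <- enum 'I_n] =
    [seq tnth [tuple f j | j < n] (p i) | i <- enum 'I_n] by [].
by move=> i; rewrite H ?mem_enum // tnth_mktuple.
Qed.

(** This moves two realizations onto a common vertex set, as [same_degrees] requires. *)
Lemma degree_bijection (G H : graph) : degree_sequence G = degree_sequence H ->
  exists2 h : vertex H -> vertex G, bijective h & forall u, degree (h u) = degree u.
Proof.
move=> E; apply: (@perm_eq_reindex _ _ (@degree G) (@degree H)).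
by rewrite -(perm_sort geq) -/(degree_sequence H) -E perm_sort.
Qed.

Local Open Scope classical_set_scope.

Section Bridge.
Variables (I : finType) (gs : I -> graph).

Definition classes (S : {set I}) : set unlabeled :=
  [set x | exists2 i, i \in S & x = iso_class (gs i)].

Lemma is_free_classes (S : {set I}) (G : graph) :
  is_free (classes S) G <-> forall i, i \in S -> ~ contains (gs i) (@adj G).
Proof.
split=> [fr i iS /contains_induced[A E]|fr A [i iS E]].
  by apply: (fr A); exists i.
by apply: (fr i iS); apply/contains_induced; exists A.
Qed.

Lemma forcing_DSF (S : {set I}) : forcing gs S -> DSF (classes S).
Proof.
move=> forS d [G Gd /is_free_classes frG] H Hd; apply/is_free_classes => i iS ci.
have [h hb hd] : exists2 h : vertex H -> vertex G, bijective h & forall u, degree (h u) = degree u.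
  by apply: degree_bijection; rewrite Gd Hd.
pose e : rel (vertex H) := relpre h (@adj G).
have se : simple_rel e by split=> [u|u v]; [apply: adj_irr|apply: adj_sym].
have deg : same_degrees (@adj H) e.
  move=> u; rewrite -[LHS]/(degree u) -hd -[LHS](on_card_preimset (onW_bij _ hb)).
  by apply: eq_card => v; rewrite !inE.
have [j jS cj] := forS _ _ _ (adj_simple H) se deg i iS ci.
by apply: (frG j jS); apply: contains_embed (bij_inj hb) _ cj.
Qed.

Lemma DSF_forcing (S : {set I}) : DSF (classes S) -> forcing gs S.
Proof.
move=> dsf T e1 e2 s1 s2 deg i iS ci.
pose r (e : rel T) : rel 'I_#|T| := relpre enum_val e.
have sr e : simple_rel e -> simple_rel (r e).
  by case=> ir sy; split=> [u|u v]; [apply: ir|apply: sy].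
have dr e u : simple_rel e -> @degree (mk_graph (r e)) u = #|nbrs e (enum_val u)|.
  move=> se; rewrite -(on_card_preimset (onW_bij _ (@enum_val_bij T))); apply: eq_card => v.
  by rewrite !inE (adj_mk_graph (sr _ se)).
have E : degree_sequence (mk_graph (r e1)) = degree_sequence (mk_graph (r e2)).
  by congr sort; apply: eq_map => u; rewrite !dr.
apply: contrapT => no.
have fr2 : is_free (classes S) (mk_graph (r e2)).
  apply/is_free_classes => j jS cj; apply: no; exists j => //.
  apply: contains_embed (@enum_val_inj _ T) _ cj => u v.
  by rewrite (adj_mk_graph (sr _ s2)).
have fr1 : is_free (classes S) (mk_graph (r e1)).
  by apply: (dsf (degree_sequence (mk_graph (r e2)))) E; exists (mk_graph (r e2)).
move/is_free_classes: fr1 => /(_ i iS); apply.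
apply: contains_embed (@enum_rank_inj T) _ ci => u v.
by rewrite (adj_mk_graph (sr _ s1)) /r /= !enum_rankK.
Qed.

End Bridge.

(** * Minimal DSF sets with a given number of elements *)

Lemma card_eq_family k (F : set unlabeled) : (F #= `I_k)%card ->
  exists2 gs : 'I_k -> graph,
    injective (fun i => iso_class (gs i)) & F = classes gs [set: 'I_k]%SET.
Proof.
move=> /card_set_bijP[f [fF fi fs]].
have /choice[g Hg] : forall i : 'I_k, exists x, F x /\ f x = i :> nat.
  by move=> i; have [x Fx fx] := fs i (ltn_ord i); exists x.
have gE i : iso_class (repr (g i)) = g i by rewrite /iso_class reprK.
exists (fun i => repr (g i)).
  move=> i j; rewrite /= !gE => E; apply: val_inj.
  by rewrite /= -(Hg i).2 -(Hg j).2 E.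
apply/seteqP; split=> x; last by case=> i _ ->; rewrite gE; case: (Hg i).
move=> Fx; pose i := Ordinal (fF x Fx); have [Fg fg] := Hg i.
by exists i => //; rewrite gE; apply: fi; rewrite ?fg ?in_setE.
Qed.

Lemma minimal_DSF_bound k (F : set unlabeled) : minimal_DSF F -> (F #= `I_k)%card ->
  exists m, m * m.-1 <= 4 * m.-1 + (4 * (k.-1 * m + k.-1 * k) + 2 * k.-1) /\
    forall G, F (iso_class G) -> num_vertices G <= m + 2 * k.-1.
Proof.
move=> [F0 dF minF] /card_eq_family[gs gi FE].
case: k gs gi FE => [|k] gs gi FE.
  by move: F0; rewrite FE => -[x [[]]].
have forT : forcing gs [set: 'I_k.+1]%SET by apply: DSF_forcing; rewrite -FE.
have out (S : {set 'I_k.+1}) : S != finset.set0 -> S != [set: 'I_k.+1]%SET ->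
    exists i l, [/\ i \in S, l \notin S & linked (gs i) (gs l)].
  move=> /set0Pn[i iS] ST; apply: linked_leaving => // /forcing_DSF.
  have [l lS] : exists l, l \notin S.
    by apply/existsP; apply: contraNT ST; rewrite -negb_forall negbK => /forallP h;
      apply/eqP/setP => l; rewrite inE h.
  apply: minF; first by exists (iso_class (gs i)); exists i.
  split=> [x [j _ ->]|sub]; first by rewrite FE; exists j; rewrite ?finset.in_setT.
  (* Distinct indices have distinct classes, so an index [l] outside [S] makes the subset proper. *)
  have [|j jS /gi lj] := sub (iso_class (gs l)).
    by rewrite FE; exists l; rewrite ?finset.in_setT.
  by rewrite lj jS in lS.
have [i0 _ i0_min] := arg_minnP (fun i => num_vertices (gs i)) (isT : predT (ord0 : 'I_k.+1)).
have i0m i : num_vertices (gs i0) <= num_vertices (gs i) by apply: i0_min.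
have cI : #|{: 'I_k.+1}| = k.+1 by rewrite card_ord.
exists (num_vertices (gs i0)); split; first exact: min_vertices_bound.
move=> G; rewrite FE => -[i _ /iso_classP/isomorphic_num_vertices ->].
by case: (sum_vertices out i0 cI).
Qed.

(** Every such set is the image under [D] of a subset of the finite type [X]. Codes in [X] are
    arbitrary, since [mk_graph] turns any of them into a graph. *)
Lemma finite_bounded_classes N : finite_set [set F : set unlabeled |
  forall G, F (iso_class G) -> num_vertices G < N].
Proof.
pose X := {n : 'I_N & {ffun 'I_n -> {ffun 'I_n -> bool}}}.
pose dec (x : X) : graph := mk_graph (fun i j => tagged x i j).
pose D (B : {set X}) : set unlabeled := [set c | exists2 x, x \in B & c = iso_class (dec x)].
apply: (@sub_finite_set _ _ (range D)); last exact/finite_image/finite_finset.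
move=> F /= bF; exists [set x : X | `[< F (iso_class (dec x)) >]]%SET => //.
apply/seteqP; split=> c; first by case=> x; rewrite inE => /asboolP + ->.
move=> Fc; pose G := repr c; have cE : c = iso_class G by rewrite /iso_class reprK.
have GN : num_vertices G < N by apply: bF; rewrite -cE.
pose x : X := Tagged (fun n : 'I_N => {ffun 'I_n -> {ffun 'I_n -> bool}})
  ([ffun i => [ffun j => adj i j]] : {ffun 'I_(Ordinal GN) -> {ffun 'I_(Ordinal GN) -> bool}}).
have xE : c = iso_class (dec x).
  rewrite cE; apply/iso_classP; exists id; first by exists id.
  move=> u v; rewrite adj_mk_graph /= ?ffunE //.
  by split=> [a|a b]; rewrite !ffunE ?adj_irr 1?adj_sym.
by exists x => //; rewrite inE; apply/asboolP; rewrite -xE.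
Qed.

Import GRing.Theory Num.Theory Order.TTheory.

Local Open Scope ring_scope.

Theorem theorem2p6 :
  (forall (R : realType) (k : nat) (F : set unlabeled),
     minimal_DSF F -> (F #= `I_k)%card ->
     forall G : graph, F (iso_class G) ->
       (num_vertices G)%:R <= 4 * k%:R - 3 / 2
                       + Num.sqrt (8 * k%:R ^+ 2 + 2 * k%:R - 31 / 4) :> R)
  /\
  (forall k : nat, (0 < k)%N ->
     finite_set [set F : set unlabeled | minimal_DSF F /\ (F #= `I_k)%card]).
Proof.
split=> [R k F mF cF G FG|k k0]; last first.
  apply: sub_finite_set (finite_bounded_classes (8 * k).+1) => F /= [mF cF] G FG.
  have [m [qm /(_ G FG)]] := minimal_DSF_bound mF cF.
  (* A crude integer bound suffices here: adding [2 * k.-1] to it keeps all orders within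
     [8 * k]. *)
  suff : (m <= 6 * k)%N by lia.
  case: k k0 qm {mF cF} => // k _ /= qm; rewrite leqNgt; apply/negP => /subnKC mE.
  by move: qm; rewrite -mE; move: (m - _)%N => d; nia.
have [m [qm /(_ G FG) Gm]] := minimal_DSF_bound mF cF.
have k0 : (0 < k)%N.
  by case: k cF {Gm qm} => // /card_eq_family[gs _ FE]; move: FG; rewrite FE => -[[]].
(* Expanding gives [2 * k + 6] in place of 8, which is its value at [k = 1]. The first alternative
   covers [m = 0], where the truncated predecessor spoils the expansion. *)
have {qm} : (m <= 2 * k)%N \/ (m * m + 8 <= (4 * k + 1) * m + 4 * k * k)%N.
  have [|lt] := leqP m (2 * k)%N; [by left|right].
  by case: k k0 qm lt {cF Gm} => [|k] //= _; case: m => [|m] //=; nia.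
have {Gm} : (num_vertices G)%:R <= m%:R + 2 * k%:R - 2 :> R.
  have : (num_vertices G + 2 <= m + 2 * k)%N by lia.
  rewrite -(ler_nat R) !(natrM, natrD); lra.
set D := _ - 31 / 4 => Gm [le|le].
  move: le; rewrite -(ler_nat R) natrM; have := sqrtr_ge0 D; lra.
suff : m%:R - 2 * k%:R - 1 / 2 <= Num.sqrt D by lra.
(* Completing the square turns the quadratic inequality into [(m - 2 * k - 1 / 2) ^+ 2 <= D]. *)
apply: le_trans (ler_norm _) _; rewrite -sqrtr_sqr; apply: ler_wsqrtr.
move: le; rewrite -(ler_nat R) !(natrM, natrD) /D; nra.
Qed.
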